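(* Let $G=(V,E)$ be a finite DAG. The maxoid fan $\mathcal{F}_G$ of $G$ coincides with the (outer) normal fan of the polytope $$P_G:=\sum_{\substack{i,j\in V\\ |P(i,j)|\ge1}}\operatorname{Newt}(f_{ij})$$ (Minkowski sum over pairs of distinct nodes $i,j$). In particular, $\mathcal{F}_G$ is the normal fan of the Newton polytope $\operatorname{Newt}\big(\prod f_{ij}\big)$ of the product of the path polynomials $f_{ij}$ over all $i,j$ with $|P(i,j)|\ge1$.
   Context: Let $G=(V,E)$ be a finite DAG. $\mathbb{R}^E$ denotes the set of weight matrices supported on $G$: $V\times V$ matrices $C=(c_{ij})$ with $c_{ij}\in\mathbb{R}$ if $i\to j\in E$ and $c_{ij}=-\infty$ otherwise (identified with the Euclidean space indexed by $E$). For distinct $i,j\in V$, $P(i,j)$ is the set of directed paths from $i$ to $j$ in $G$, and the weight of a path $\pi$ is $\omega_C(\pi)=\sum_{e\in\pi}c_e$. A path in $P(i,j)$ is critical (for $(G,C)$) if its weight is maximal among all paths in $P(i,j)$. $C$ is generic if for all distinct $i,j$ with $P(i,j)\ne\emptyset$ there is exactly one critical path from $i$ to $j$. For $L\subseteq V$, the critical DAG $G^*_{C,L}$ is the DAG on $V$ with an edge $i\to j$ ($i\neq j$) if and only if $P(i,j)\neq\emptyset$ and no critical path from $i$ to $j$ in $(G,C)$ has an interior node in $L$. Distinct $i,j\in V\setminus L$ are $C^*$-connected given $L$ if $G^*_{C,L}$ contains, up to exchanging $i$ and $j$, a path of one of the forms (a) $i\to j$; (b) $i\leftarrow p\to j$;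 (c) $i\to \ell\leftarrow j$; (d) $i\leftarrow p\to\ell\leftarrow j$; (e) $i\leftarrow p\to\ell\leftarrow q\to j$, with $\ell\in L$ and $p,q\notin L$. Otherwise they are $C^*$-separated given $L$. For pairwise disjoint $I,J,L\subseteq V$, $I$ and $J$ are $C^*$-separated given $L$ if every $i\in I$ and $j\in J$ are $C^*$-separated given $L$. The maxoid $\mathcal{M}_*(G,C)$ is the set of all triples (CI statements) $[I\perp\!\!\!\perp J\mid L]$ with $I,J,L$ pairwise disjoint such that $I$ and $J$ are $C^*$-separated given $L$ in $(G,C)$. For generic $C$, $\operatorname{cone}_G(C)=\{C'\in\mathbb{R}^E: C'\text{ generic},\ \mathcal{M}_*(G,C')=\mathcal{M}_*(G,C)\}$. The maxoid fan $\mathcal{F}_G$ is the complete polyhedral fan in $\mathbb{R}^E$ consisting of the Euclidean closures of the sets $\operatorname{cone}_G(C)$, $C$ generic, and all their faces. The path polynomial of a pair $i,j$ with $|P(i,j)|\geq1$ is $f_{ij}=\sum_{\pi\in P(i,j)}\prod_{u\to v\in\pi}x_{uv}\in\mathbb{R}[x_{uv}:u\to v\in E]$. $\operatorname{Newt}(f)\subset\mathbb{R}^E$ is the convex hull of the exponent vectors of the terms of $f$. The outer normal fan of a polytope $P\subset\mathbb{R}^E$ consists of the cones $N_F=\{c: \langle c,x\rangle=\max_{y\in P}\langle c,y\rangle\text{ for all }x\in F\}$ for the non-empty faces $F$ of $P$. *)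

(* Defs.v *)
From HB Require Import structures.
From mathcomp Require Import all_boot all_order all_algebra.
From mathcomp Require Import all_classical all_reals all_analysis.
(* The notations of [mpoly] clash with those of analysis: {mpoly R[n]} is
   written [mpoly n R], and the variable 'X_i is [mpolyX R (mnm1 i)]. *)
From mathcomp Require Import -(notations) mpoly.

Set Implicit Arguments.
Unset Strict Implicit.
Unset Printing Implicit Defensive.

Import Order.TTheory GRing.Theory Num.Theory.
Import numFieldNormedType.Exports.

Local Open Scope ring_scope.

Section Digraph.
Variables (V : finType) (E : rel V).

Definition acyclic : Prop := forall p : seq V, cycle E p -> p = [::].

Definition edge : finType := {e : V * V | E e.1 e.2}.

(* A path i -> v_1 -> ... -> v_k = j is encoded by the sequence v_1 ... v_k.
   Its nodes are distinct, so k < #|V| and bounded sequences suffice.  Only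
   used for i != j: [paths i i] contains just the empty sequence. *)
Definition paths (i j : V) : {set #|V|.-bseq V} :=
  [set p : #|V|.-bseq V | [&& path E i p, last i p == j & uniq (i :: p)]].

Definition path_edges (i : V) (p : seq V) : {set edge} :=
  [set e | val e \in zip (i :: p) p].

Definition interior_nodes (i : V) (p : seq V) : {set V} :=
  [set k | (k \in p) && (k != last i p)].

(* The index set of both the Minkowski sum and the product. *)
Definition path_pair (ij : V * V) : bool :=
  (ij.1 != ij.2) && (0 < #|paths ij.1 ij.2|)%N.

End Digraph.

(* The space of weight matrices supported on the digraph: coordinate
   [enum_rank e] is the weight of the edge [e], and absent entries (weight
   -oo) are not represented. *)
Notation weights R E := 'rV[R]_#|edge E|.

Section Maxoid.
Variables (R : realType) (V : finType) (E : rel V) (C : weights R E).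

Definition path_weight (i : V) (p : seq V) : R :=
  \sum_(e in path_edges E i p) C 0 (enum_rank e).

Definition critical (i j : V) (p : #|V|.-bseq V) : bool :=
  (p \in paths E i j) &&
  [forall q in paths E i j, path_weight i q <= path_weight i p].

Definition generic : bool :=
  [forall i, forall j, (i != j) && (0 < #|paths E i j|)%N ==>
    (#|[set p | critical i j p]| == 1)%N].

Definition crit_dag (L : {set V}) : rel V := fun i j =>
  [&& i != j, (0 < #|paths E i j|)%N &
    [forall p, critical i j p ==> [disjoint interior_nodes i p & L]]].

(* i -> j;  i <- p -> j;  i -> l <- j;  i <- p -> l <- j;
   i <- p -> l <- q -> j;  on distinct nodes, with l in L and p, q not in L. *)
Definition cstar_path (L : {set V}) (i j : V) : bool :=
  let G := crit_dag L in
  [|| G i j,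
      [exists p, [&& p \notin L, uniq [:: i; p; j], G p i & G p j]],
      [exists l in L, [&& uniq [:: i; l; j], G i l & G j l]],
      [exists p, exists l in L,
        [&& p \notin L, uniq [:: i; p; l; j], G p i, G p l & G j l]] |
      [exists p, exists l in L, exists q,
        [&& p \notin L, q \notin L, uniq [:: i; p; l; q; j],
            G p i, G p l, G q l & G q j]]].

Definition cstar_connected (L : {set V}) (i j : V) : bool :=
  cstar_path L i j || cstar_path L j i.

Definition cstar_separated (A B L : {set V}) : bool :=
  [forall i in A, forall j in B, ~~ cstar_connected L i j].

(* The triple (A, B, L) stands for the statement [A _||_ B | L]. *)
Definition maxoid : {set {set V} * {set V} * {set V}} :=
  [set t : {set V} * {set V} * {set V} | let: (A, B, L) := t in
    [&& [disjoint A & B], [disjoint A & L], [disjoint B & L] &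
        cstar_separated A B L]].

End Maxoid.

Arguments generic {R V} E C.
Arguments maxoid {R V} E C.

Section PathPolynomial.
Variables (R : realType) (V : finType) (E : rel V).

(* Variable number [enum_rank e] stands for x_uv with e = (u, v). *)
Definition path_poly (ij : V * V) : mpoly #|edge E| R :=
  \sum_(p in paths E ij.1 ij.2) \prod_(e in path_edges E ij.1 p)
    mpolyX R (mnm1 (enum_rank e : 'I_#|edge E|)).

End PathPolynomial.

Local Open Scope classical_set_scope.

Section Polyhedra.
Variables (R : realType) (n : nat).
Implicit Types (A B P F N : set 'rV[R]_n).

Definition dotp (c x : 'rV[R]_n) : R := \sum_i c 0 i * x 0 i.

Definition convex_hull A : set 'rV[R]_n :=
  [set x | exists (k : nat) (w : 'I_k -> R) (a : 'I_k -> 'rV[R]_n),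
    [/\ forall i, 0 <= w i, \sum_i w i = 1, forall i, A (a i) &
        x = \sum_i w i *: a i]].

Definition minkowski_sum A B : set 'rV[R]_n :=
  [set a + b | a in A & b in B].

(* Nonempty faces of a polyhedron P; the functional a = 0 gives P itself. *)
Definition face P F : Prop :=
  F !=set0 /\
  exists a : 'rV[R]_n, F = [set x | P x /\ forall y, P y -> dotp a y <= dotp a x].

Definition normal_cone P F : set 'rV[R]_n :=
  [set c | forall x, F x -> forall y, P y -> dotp c y <= dotp c x].

Definition outer_normal_fan P : set (set 'rV[R]_n) :=
  [set N | exists2 F, face P F & N = normal_cone P F].

Definition newton (f : mpoly n R) : set 'rV[R]_n :=
  convex_hull [set \row_i (m i)%:R | m in [set` msupp f]].

End Polyhedra.

Section MaxoidFan.
Variables (R : realType) (V : finType) (E : rel V).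

Definition maxoid_cone (C : weights R E) : set (weights R E) :=
  [set C' | generic E C' /\ maxoid E C' = maxoid E C].

Definition maxoid_fan : set (set (weights R E)) :=
  [set N | exists2 C : weights R E, generic E C &
    face (closure (maxoid_cone C)) N].

Definition path_polytope : set (weights R E) :=
  \big[@minkowski_sum R _/[set 0]]_(ij | path_pair E ij)
    newton (path_poly R E ij).

End MaxoidFan.

Arguments maxoid_fan R {V} E _.
Arguments path_polytope R {V} E _.

(* Main.v *)
(* Both fans equal the set of cones
     N(a) = {c : for all i, j, each a-maximal path i -> j is c-maximal},
   with [a] ranging over the weights.
   - For the polytope, the a-maximal face of a Minkowski sum of convex hulls
     determines and is determined by the a-maximal generators of each summand;
     Newton polytopes of products are Minkowski sums because path polynomials
     have nonnegative coefficients.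
   - For the maxoid fan, the maxoid of a generic [C] determines its critical
     paths: if the critical paths from i for C and C' first diverge as i -> x
     and i -> x' with x not reachable from x', then conditioning on all nodes
     other than i that reach x separates i from the endpoint for C but not for
     C'. Hence the closure of [maxoid_cone C] is N(C). Its faces are the N(a)
     with [a] in N(C), and every [a] lies in such an N(C): take C = k a + g
     with k large and [g] giving distinct weights to distinct paths (powers
     of 2 as edge weights). *)
Require Import Defs.
From mathcomp Require Import all_boot all_order all_algebra.
From mathcomp Require Import all_classical all_reals all_analysis.
From mathcomp Require Import -(notations) mpoly.
From mathcomp Require Import lra.

Set Implicit Arguments.
Unset Strict Implicit.
Unset Printing Implicit Defensive.

Import Order.TTheory GRing.Theory Num.Theory.
Import numFieldNormedType.Exports.

Local Open Scope classical_set_scope.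
Local Open Scope ring_scope.

(** * Bilinearity and continuity of the dot product *)

Section DotProduct.
Variables (R : realType) (n : nat).
Implicit Types (c x y : 'rV[R]_n) (k : R).

Lemma dotpC c x : dotp c x = dotp x c.
Proof. by apply: eq_bigr => i _; rewrite mulrC. Qed.

Lemma dotpDr c x y : dotp c (x + y) = dotp c x + dotp c y.
Proof. by rewrite -big_split; apply: eq_bigr => i _; rewrite mxE mulrDr. Qed.

Lemma dotpZr c k x : dotp c (k *: x) = k * dotp c x.
Proof. by rewrite mulr_sumr; apply: eq_bigr => i _; rewrite mxE mulrCA. Qed.

Lemma dotp0 c : dotp c 0 = 0.
Proof. by rewrite -(scale0r 0) dotpZr mul0r. Qed.

Lemma dotpBr c x y : dotp c (x - y) = dotp c x - dotp c y.
Proof. by rewrite dotpDr -scaleN1r dotpZr mulN1r. Qed.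

Lemma dotpDl c x y : dotp (x + y) c = dotp x c + dotp y c.
Proof. by rewrite !(dotpC _ c) dotpDr. Qed.

Lemma dotpZl c k x : dotp (k *: x) c = k * dotp x c.
Proof. by rewrite !(dotpC _ c) dotpZr. Qed.

Lemma dotpBl c x y : dotp (x - y) c = dotp x c - dotp y c.
Proof. by rewrite !(dotpC _ c) dotpBr. Qed.

Lemma dotp_sumr c (I : Type) (r : seq I) (P : pred I) (F : I -> 'rV[R]_n) :
  dotp c (\sum_(i <- r | P i) F i) = \sum_(i <- r | P i) dotp c (F i).
Proof. exact: (big_morph (dotp c) (dotpDr c) (dotp0 c)). Qed.

Lemma dotp_suml c (I : Type) (r : seq I) (P : pred I) (F : I -> 'rV[R]_n) :
  dotp (\sum_(i <- r | P i) F i) c = \sum_(i <- r | P i) dotp (F i) c.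
Proof. by rewrite dotpC dotp_sumr; apply: eq_bigr => i _; rewrite dotpC. Qed.

Lemma continuous_dotp x : continuous (fun c => dotp c x).
Proof.
rewrite /dotp; elim: (index_enum _) => [|i s IHs] c.
  rewrite (_ : (fun _ => _) = cst 0); first exact: cst_continuous.
  by rewrite funeqE => ?; rewrite big_nil.
rewrite (_ : (fun _ => _) = fun c =>
    c 0 i * x 0 i + \sum_(j <- s) c 0 j * x 0 j); last first.
  by rewrite funeqE => ?; rewrite big_cons.
have ci : {for c, continuous (fun c : 'rV[R]_n => c 0 i)}.
  exact: coord_continuous.
have xi : {for c, continuous (fun=> x 0 i : R)} by exact: cst_continuous.
exact: continuousD (continuousM ci xi) (IHs c).
Qed.

End DotProduct.

(** * Maximal faces of Minkowski sums and convex hulls *)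

Section Argmax.
Variables (R : realType) (n : nat).
Implicit Types (A B P F : set 'rV[R]_n) (a c : 'rV[R]_n).

Definition argmax c A : set 'rV[R]_n :=
  [set x | A x /\ forall y, A y -> dotp c y <= dotp c x].

Lemma argmax_le a A x y : argmax a A x -> A y -> dotp a y <= dotp a x.
Proof. by case=> _; apply. Qed.

Lemma normal_cone_argmax P a :
  normal_cone P (argmax a P) = [set c | argmax a P `<=` argmax c P].
Proof.
apply/seteqP; split=> c /= cP x ax; first by split=> [|y]; [case: ax | exact: cP].
by move=> y; case: (cP x ax) => _; apply.
Qed.

(** Faces are by definition the nonempty sets [argmax a P]; since every functional attains its
    maximum on [P], the fan is indexed by all [a]. *)
Lemma outer_normal_fanE P : (forall a, argmax a P !=set0) ->
  outer_normal_fan P = range (fun a => [set c | argmax a P `<=` argmax c P]).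
Proof.
move=> P0; apply/seteqP; split=> N /=.
  by move=> [_ [_ [a ->]] ->]; exists a => //; rewrite -normal_cone_argmax.
by move=> [a _ <-]; exists (argmax a P); [split=> //; exists a |
  rewrite normal_cone_argmax].
Qed.

Lemma argmax_minkowski a A B :
  argmax a (minkowski_sum A B) = minkowski_sum (argmax a A) (argmax a B).
Proof.
apply/seteqP; split=> [_ [[x Ax [y By <-]] xy_max]|_ [x ax [y ay <-]]].
  exists x; last exists y => //; split=> // z ?.
    have := xy_max (z + y) (ex_intro2 _ _ z _ (ex_intro2 _ _ y _ erefl)).
    by rewrite !dotpDr lerD2r; apply.
  have := xy_max (x + z) (ex_intro2 _ _ x _ (ex_intro2 _ _ z _ erefl)).
  by rewrite !dotpDr lerD2l; apply.
split; first by exists x; [case: ax | exists y => //; case: ay].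
by move=> _ [z Az [w Bw <-]]; rewrite !dotpDr lerD // (argmax_le ax, argmax_le ay).
Qed.

Lemma argmax_set0 a : argmax a [set 0] = [set 0].
Proof. by apply/seteqP; split=> x /= => [[]//|->]; split=> // y ->. Qed.

Lemma minkowski_sum_nonempty A B :
  A !=set0 -> B !=set0 -> minkowski_sum A B !=set0.
Proof. by move=> [x ?] [y ?]; exists (x + y), x => //; exists y. Qed.

Lemma argmax_minkowski_nonempty a A B : argmax a A !=set0 ->
  argmax a B !=set0 -> argmax a (minkowski_sum A B) !=set0.
Proof. by move=> *; rewrite argmax_minkowski; exact: minkowski_sum_nonempty. Qed.

(** Maximizers of a sum are sums of maximizers. To recover the condition on one summand, keep a
    maximizer of the other fixed and cancel it. *)
Lemma sub_argmax_minkowski a c A B : argmax a A !=set0 -> argmax a B !=set0 ->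
  argmax a (minkowski_sum A B) `<=` argmax c (minkowski_sum A B) <->
  argmax a A `<=` argmax c A /\ argmax a B `<=` argmax c B.
Proof.
move=> [x0 ax0] [y0 ay0]; split=> [acAB|[acA acB]].
  split=> z az.
    have [|_ zy_max] := acAB (z + y0).
      by rewrite argmax_minkowski; exists z => //; exists y0.
    split=> [|u Au]; first by case: az.
    have := zy_max (u + y0) (ex_intro2 _ _ u Au (ex_intro2 _ _ y0 ay0.1 erefl)).
    by rewrite !dotpDr lerD2r.
  have [|_ xz_max] := acAB (x0 + z).
    by rewrite argmax_minkowski; exists x0 => //; exists z.
  split=> [|u Bu]; first by case: az.
  have := xz_max (x0 + u) (ex_intro2 _ _ x0 ax0.1 (ex_intro2 _ _ u Bu erefl)).
  by rewrite !dotpDr lerD2l.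
rewrite !argmax_minkowski => _ [x ax [y ay <-]].
by exists x; [exact: acA | exists y => //; exact: acB].
Qed.

Section BigMinkowski.
Variables (I : eqType) (A : I -> set 'rV[R]_n) (D : pred I).
Hypothesis A0 : forall a i, D i -> argmax a (A i) !=set0.

Lemma argmax_big_nonempty (r : seq I) a :
  argmax a (\big[@minkowski_sum R n/[set 0]]_(i <- r | D i) A i) !=set0.
Proof.
elim/big_ind: _ => [|B C|i Di]; last exact: A0.
  by exists 0; rewrite argmax_set0.
exact: argmax_minkowski_nonempty.
Qed.

Lemma sub_argmax_big (r : seq I) a c :
  argmax a (\big[@minkowski_sum R n/[set 0]]_(i <- r | D i) A i) `<=`
  argmax c (\big[@minkowski_sum R n/[set 0]]_(i <- r | D i) A i) <->
  forall i, i \in r -> D i -> argmax a (A i) `<=` argmax c (A i).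
Proof.
elim: r => [|j s IHs].
  by rewrite !big_nil !argmax_set0; split=> [_ i|_ x //]; rewrite in_nil.
rewrite !big_cons; case: ifPn => Dj.
  rewrite sub_argmax_minkowski; [|exact: A0|exact: argmax_big_nonempty].
  rewrite IHs //; split=> [[acj acs] i|ac].
    by rewrite inE => /predU1P[->//|/acs].
  by split=> [|i si]; apply: ac; rewrite ?mem_head // inE si orbT.
rewrite IHs //; split=> ac i; last by move=> si; apply: ac; rewrite inE si orbT.
by rewrite inE => /predU1P[->|/ac//]; rewrite (negPf Dj).
Qed.

End BigMinkowski.

Section ConvexHull.
Implicit Types S : set 'rV[R]_n.

Lemma convex_hull_sub S : S `<=` convex_hull S.
Proof.
move=> x Sx; exists 1%N, (fun=> 1), (fun=> x).
by split=> //; rewrite big_ord1 ?scale1r.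
Qed.

Lemma convex_hull_le S c m : (forall x, S x -> dotp c x <= m) ->
  forall x, convex_hull S x -> dotp c x <= m.
Proof.
move=> Sm _ [k [w [p [w0 w1 Sp ->]]]]; rewrite dotp_sumr -[m]mul1r -w1 mulr_suml.
by apply: ler_sum => i _; rewrite dotpZr ler_wpM2l ?w0 ?Sm.
Qed.

Lemma argmax_convex_hull_nonempty S a :
  argmax a S !=set0 -> argmax a (convex_hull S) !=set0.
Proof.
move=> [x [Sx x_max]]; exists x; split; first exact: convex_hull_sub.
exact: convex_hull_le.
Qed.

(** An [a]-maximal point of the hull averages only [a]-maximal generators; if these are all
    [c]-maximal, so is the average. *)
Lemma sub_argmax_convex_hull S a c : argmax a S !=set0 ->
  argmax a (convex_hull S) `<=` argmax c (convex_hull S) <->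
  argmax a S `<=` argmax c S.
Proof.
move=> [x0 [Sx0 x0_max]]; split=> ac x.
  move=> [Sx x_max]; have [|_ cx] := ac x.
    by split; [exact: convex_hull_sub | exact: convex_hull_le].
  by split=> // y Sy; apply/cx/convex_hull_sub.
(* The generator [x0] is also [c]-maximal, so it bounds [dotp c y]; it remains to see that [x] does
   at least as well as [x0]. *)
move=> [Cx x_max]; split=> // y Cy; have [_ cx0] := ac x0 (conj Sx0 x0_max).
apply: le_trans (convex_hull_le cx0 Cy) _.
have := x_max x0 (convex_hull_sub Sx0).
case: Cx => k [w [p [w0 w1 Sp ->]]] {x x_max}.
rewrite !dotp_sumr -{1}[dotp a x0]mul1r -{1}[dotp c x0]mul1r -w1 !mulr_suml => a_le.
(* Points of positive weight must be [a]-maximal, hence [c]-maximal. *)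
have a_eq i : w i * dotp a x0 = w i * dotp a (p i).
  have le_i j : w j * dotp a (p j) <= w j * dotp a x0.
    by rewrite ler_wpM2l ?w0 ?x0_max.
  apply/eqP; rewrite eq_le le_i andbT -subr_le0.
  rewrite -[X in X <= _]/((fun j => w j * dotp a x0 - w j * dotp a (p j)) i).
  (* The deficits are nonnegative, so each is at most their sum, and that sum is nonpositive by
     [a_le]. *)
  apply: (@le_trans _ _ (\sum_j (w j * dotp a x0 - w j * dotp a (p j)))).
    by rewrite (bigD1 i) //= lerDl sumr_ge0 // => j _; rewrite subr_ge0.
  rewrite sumrB subr_le0; apply: le_trans a_le _.
  by apply: ler_sum => j _; rewrite dotpZr.
apply: ler_sum => i _; rewrite dotpZr.
have [->|wi0] := eqVneq (w i) 0; first by rewrite !mul0r.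
have ax_i : dotp a x0 = dotp a (p i) by apply: (mulfI wi0).
have [_ cpi] : argmax c S (p i) by apply: ac; split=> // y' /x0_max; rewrite ax_i.
by rewrite ler_wpM2l ?w0 ?cpi.
Qed.

Lemma convex_hull0 : convex_hull [set 0] = [set (0 : 'rV[R]_n)].
Proof.
apply/seteqP; split=> [_ [k [w [p [_ _ p0 ->]]]]|]; last exact: convex_hull_sub.
by rewrite big1 // => i _; rewrite (p0 i) scaler0.
Qed.

Lemma minkowski_sum_convex_hull A B :
  minkowski_sum (convex_hull A) (convex_hull B) =
  convex_hull (minkowski_sum A B).
Proof.
apply/seteqP; split.
  move=> _ [_ [k [w [p [w0 w1 Ap ->]]]] [_ [l [u [q [u0 u1 Bq ->]]]] <-]].
  (* Product weights on pairs of points. *)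
  exists #|{: 'I_k * 'I_l}|, (fun i => w (enum_val i).1 * u (enum_val i).2),
    (fun i => p (enum_val i).1 + q (enum_val i).2); split.
  - by move=> i; rewrite mulr_ge0.
  - rewrite -(reindex enum_val (P := xpredT) (F := fun z => w z.1 * u z.2)) /=.
      rewrite -(pair_bigA _ (fun i j => w i * u j)) /= -w1.
      by apply: eq_bigr => i _; rewrite -mulr_sumr u1 mulr1.
    by apply: onW_bij; exact: enum_val_bij.
  - by move=> i; exists (p (enum_val i).1) => //; exists (q (enum_val i).2).
  rewrite -(reindex enum_val (P := xpredT)
    (F := fun z => (w z.1 * u z.2) *: (p z.1 + q z.2))) /=; last first.
    by apply: onW_bij; exact: enum_val_bij.
  rewrite -(pair_bigA _ (fun i j => (w i * u j) *: (p i + q j))) /=.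
  transitivity (\sum_i (w i *: p i + w i *: \sum_j u j *: q j)).
    by rewrite big_split /= -scaler_suml w1 scale1r.
  apply: eq_bigr => i _; rewrite scaler_sumr -[in LHS](scale1r (p i)) -u1.
  rewrite scaler_suml scaler_sumr -big_split /=.
  by apply: eq_bigr => j _; rewrite !scalerA scalerDr.
move=> _ [k [w [p [w0 w1 ABp ->]]]].
have /choice[f fP] i : exists ab : 'rV[R]_n * 'rV[R]_n,
    [/\ A ab.1, B ab.2 & p i = ab.1 + ab.2].
  by case: (ABp i) => x Ax [y By <-]; exists (x, y).
exists (\sum_i w i *: (f i).1).
  by exists k, w, (fun i => (f i).1); split=> // i; case: (fP i).
exists (\sum_i w i *: (f i).2).
  by exists k, w, (fun i => (f i).2); split=> // i; case: (fP i).
by rewrite -big_split; apply: eq_bigr => i _; case: (fP i) => _ _ ->; rewrite scalerDr.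
Qed.

End ConvexHull.

End Argmax.

(** * Newton polytopes of products of polynomials with nonnegative coefficients *)

Section Newton.
Variables (R : realType) (n : nat).
Implicit Types f g : mpoly n R.

(** Excludes cancellation, so that supports of products are sumsets of supports. *)
Definition nonneg_coef f := forall m, 0 <= mcoeff m f.

Lemma nonneg_coefX m : nonneg_coef (mpolyX R m).
Proof. by move=> k; rewrite mcoeffX ler0n. Qed.

Lemma nonneg_coef_sum (I : Type) (r : seq I) (P : pred I) (F : I -> mpoly n R) :
  (forall i, P i -> nonneg_coef (F i)) -> nonneg_coef (\sum_(i <- r | P i) F i).
Proof. by move=> F0 m; rewrite raddf_sum sumr_ge0 // => i /F0; apply. Qed.

(** The coefficient of the product at [k + l] is a sum of nonnegative terms, one of which is the
    positive product of the coefficients at [k] and [l]. *)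
Lemma mem_msuppM f g m : nonneg_coef f -> nonneg_coef g ->
  reflect (exists k l, [/\ k \in msupp f, l \in msupp g & m = mnm_add k l])
    (m \in msupp (f * g)).
Proof.
move=> f0 g0; apply: (iffP idP) => [/msuppM_le/allpairsP[[k l] [/= kf lg ->]]|].
  by exists k, l.
move=> [k [l [kf lg ->]]]; rewrite mcoeff_msupp mpolyME raddf_sum /=.
rewrite psumr_neq0 => [|kl _]; last by rewrite mcoeffZ mcoeffX !mulr_ge0.
apply/hasP; exists (k, l); first exact: allpairs_f.
by rewrite mcoeffZ mcoeffX eqxx mulr1 lt0r mulr_ge0 // mulf_neq0 -?mcoeff_msupp.
Qed.

Lemma nonneg_coefM f g : nonneg_coef f -> nonneg_coef g -> nonneg_coef (f * g).
Proof.
move=> f0 g0 m; rewrite mpolyME raddf_sum sumr_ge0 // => kl _.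
by rewrite /= mcoeffZ mcoeffX !mulr_ge0.
Qed.

Lemma nonneg_coef1 : nonneg_coef 1.
Proof. by move=> m; rewrite mcoeff1 ler0n. Qed.

Lemma nonneg_coef_prod (I : Type) (r : seq I) (P : pred I) (F : I -> mpoly n R) :
  (forall i, P i -> nonneg_coef (F i)) -> nonneg_coef (\prod_(i <- r | P i) F i).
Proof.
move=> F0; elim/big_ind: _ => //; [exact: nonneg_coef1 | exact: nonneg_coefM].
Qed.

Lemma newtonM f g : nonneg_coef f -> nonneg_coef g ->
  newton (f * g) = minkowski_sum (newton f) (newton g).
Proof.
move=> f0 g0; rewrite minkowski_sum_convex_hull; congr convex_hull.
apply/seteqP; split.
  move=> _ [m /(mem_msuppM _ f0 g0)[k [l [kf lg ->]]] <-].
  exists (\row_i (k i)%:R); first by exists k.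
  exists (\row_i (l i)%:R); first by exists l.
  by apply/rowP => i; rewrite !mxE mnmDE natrD.
move=> _ [_ [k kf <-] [_ [l lg <-] <-]]; exists (mnm_add k l).
  by apply/(mem_msuppM _ f0 g0); exists k, l.
by apply/rowP => i; rewrite !mxE mnmDE natrD.
Qed.

Lemma newton1 : newton (1 : mpoly n R) = [set 0].
Proof.
rewrite -convex_hull0; congr convex_hull; apply/seteqP; split=> x /=.
  move=> [m]; rewrite msupp1 inE => /eqP -> <-.
  by apply/rowP => i; rewrite !mxE mnm0E.
move=> ->; exists mnm0; first by rewrite msupp1 inE.
by apply/rowP => i; rewrite !mxE mnm0E.
Qed.

Lemma newton_prod (I : Type) (r : seq I) (P : pred I) (F : I -> mpoly n R) :
  (forall i, P i -> nonneg_coef (F i)) ->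
  newton (\prod_(i <- r | P i) F i) =
  \big[@minkowski_sum R n/[set 0]]_(i <- r | P i) newton (F i).
Proof.
move=> F0; elim: r => [|i r IHr]; first by rewrite !big_nil newton1.
rewrite !big_cons; case: ifPn => // Pi.
by rewrite newtonM ?IHr; [|exact: F0|exact: nonneg_coef_prod].
Qed.

End Newton.

(** * Cones of functionals that preserve maximizers in finite families of points *)

Section SelectionCones.
Variables (R : realType) (n : nat) (I T : finType).
Variables (D : I -> {set T}) (v : I -> T -> 'rV[R]_n).
Implicit Types (a b c x y : 'rV[R]_n) (i : I) (p q : T).

(** In the application [i] is a pair of nodes, [D i] its set of paths and [v i p] the edge indicator
    of [p], so that these are the critical paths for the weights [c]. *)
Definition maxes c i : {set T} :=
  [set p in D i | [forall q in D i, dotp c (v i q) <= dotp c (v i p)]]%SET.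

Lemma maxesP c i p :
  reflect (p \in D i /\ forall q, q \in D i -> dotp c (v i q) <= dotp c (v i p))
    (p \in maxes c i).
Proof. by rewrite inE; apply: (iffP andP) => -[Dp /forall_inP]. Qed.

Lemma maxes_dom c i p : p \in maxes c i -> p \in D i.
Proof. by case/maxesP. Qed.

Lemma maxes_le c i p q :
  p \in maxes c i -> q \in D i -> dotp c (v i q) <= dotp c (v i p).
Proof. by case/maxesP=> _; apply. Qed.

Lemma maxes_eq c i p q : p \in maxes c i -> q \in maxes c i ->
  dotp c (v i p) = dotp c (v i q).
Proof.
move=> cp cq; apply: le_anti.
by rewrite (maxes_le cq (maxes_dom cp)) (maxes_le cp (maxes_dom cq)).
Qed.

Lemma maxes_trans c i p q : p \in maxes c i -> q \in D i ->
  dotp c (v i p) <= dotp c (v i q) -> q \in maxes c i.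
Proof.
move=> cp Dq pq; apply/maxesP; split=> // r Dr.
exact: le_trans (maxes_le cp Dr) pq.
Qed.

Lemma maxes_nonempty c i p : p \in D i -> exists q, q \in maxes c i.
Proof.
move=> Dp; have [q Dq q_max] := @arg_maxP _ _ _ p (mem (D i)) (dotp c \o v i) Dp.
by exists q; apply/maxesP; split.
Qed.

Lemma maxesZ k c i : 0 < k -> maxes (k *: c) i = maxes c i.
Proof.
move=> k0; apply/setP => p; apply/maxesP/maxesP => -[Dp p_max]; split=> // q /p_max.
  by rewrite !dotpZl ler_pM2l.
by rewrite !dotpZl ler_pM2l.
Qed.

(** Through the common maximizer [p] the maximum of the sum is the sum of the maxima, which is
    reached only where both are. *)
Lemma maxesD c x i p : p \in maxes c i -> p \in maxes x i ->
  maxes (c + x) i = (maxes c i :&: maxes x i)%SET.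
Proof.
move=> cp xp; apply/setP => q; rewrite finset.in_setI; apply/idP/andP.
  move=> cxq; have Dq := maxes_dom cxq.
  have := maxes_le cxq (maxes_dom cp); rewrite !dotpDl => le_pq.
  have := maxes_le cp Dq; have := maxes_le xp Dq => le_x le_c.
  by split; [apply: (maxes_trans cp) | apply: (maxes_trans xp)] => //; lra.
move=> [cq xq]; apply/maxesP; split=> [|r Dr]; first exact: maxes_dom cq.
by rewrite !dotpDl lerD ?(maxes_le cq) ?(maxes_le xq).
Qed.

(** The cone N(a), for an abstract family of point sets. *)
Definition sel_cone a : set 'rV[R]_n :=
  [set c | forall i, maxes a i \subset maxes c i].

Lemma sel_cone_refl a : sel_cone a a.
Proof. by []. Qed.

Lemma sel_cone0 a : sel_cone a 0.
Proof.
move=> i; apply/fintype.subsetP => p /maxes_dom Dp; apply/maxesP; split=> // q _.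
by rewrite !(dotpC 0) !dotp0.
Qed.

Lemma sel_coneD a c x : sel_cone a c -> sel_cone a x -> sel_cone a (c + x).
Proof.
move=> ac ax i; apply/fintype.subsetP => p ap.
have cp := fintype.subsetP (ac i) p ap; have xp := fintype.subsetP (ax i) p ap.
by rewrite (maxesD cp xp) inE cp.
Qed.

Lemma maxes_perturb a c k i : 0 < k -> sel_cone a c ->
  maxes (c + k *: a) i = maxes a i.
Proof.
move=> k0 ac; have [D0|[p Dp]] := set_0Vmem (D i).
  by apply/setP => p; rewrite !inE D0 inE.
have [q aq] := maxes_nonempty a Dp; have cq := fintype.subsetP (ac i) q aq.
rewrite (maxesD cq (p := q)) maxesZ //; apply/finset.setIidPr; exact: ac.
Qed.

(** The cone is cut out by weak linear inequalities, which survive limits. Conversely [c + k *: a]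
    has exactly the maximizers of [a] for every positive [k], and tends to [c] as [k] tends to 0. *)
Lemma closure_maxes a :
  closure [set c | forall i, maxes c i = maxes a i] = sel_cone a.
Proof.
apply/seteqP; split=> c.
  move=> cl_c i; apply/fintype.subsetP => p ap; apply/maxesP; split=> [|q Dq].
    exact: maxes_dom ap.
  rewrite leNgt; apply/negP => lt_pq.
  have [|x [/= ax]] := cl_c [set x | 0 < dotp x (v i q - v i p)].
    have := @continuous_dotp R n (v i q - v i p) c.
    by move/cvgr_gt; apply; rewrite dotpBr subr_gt0.
  apply/negP; rewrite -leNgt dotpBr subr_le0; apply: maxes_le => //.
  by rewrite ax.
move=> ac B Bc; pose f k := c + k *: a.
have f0 : f k @[k --> 0^'+] --> c.
  apply: cvg_at_right_filter; rewrite -[X in _ --> X]addr0 -(scale0r a).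
  by apply: cvgD; [exact: cvg_cst | exact: cvgZr_tmp].
have [k [Bk k0]] : exists k, B (f k) /\ 0 < k.
  apply: (@filter_ex _ (0^'+ : set_system R)); apply: filterI; first exact: f0.
  exact: nbhs_right_gt.
by exists (f k); split=> // i; exact: maxes_perturb.
Qed.

(* For a large factor, [a] decides and [y] only breaks ties. *)
Lemma lexicographic_perturbation a y : exists2 k, 0 < k &
  forall i p q, dotp a (v i q) < dotp a (v i p) ->
    dotp (k *: a + y) (v i q) < dotp (k *: a + y) (v i p).
Proof.
pose w (t : I * T * T) := v t.1.1 t.1.2 - v t.1.1 t.2.
(* [m t] is the factor at which [a] outweighs [y] on the difference [w t]; it is applied only where
   [a] is positive on [w t]. The sum of all [m t] bounds each of them, and the added 1 makes the
   inequality strict. *)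
pose m t := `|dotp y (w t)| / `|dotp a (w t)|.
have m0 t : 0 <= m t by rewrite divr_ge0.
have s0 : 0 <= \sum_t m t by exact: sumr_ge0.
exists (1 + \sum_t m t); first by rewrite ltr_pwDl.
move=> i p q; rewrite -![_ < dotp _ (v i p)]subr_gt0 -!dotpBr.
rewrite -[v i p - _]/(w (i, p, q)); set t := (i, p, q) => at0.
rewrite dotpDl dotpZl mulrDl mul1r -addrA ltr_pwDl //.
apply: (@le_trans _ _ (m t * dotp a (w t) + dotp y (w t))).
  by rewrite /m (gtr0_norm at0) divfK ?gt_eqF // -lerBlDr sub0r ler_normr lexx orbT.
by rewrite lerD2r ler_pM2r // (bigD1 t) //= lerDl sumr_ge0.
Qed.

(** Maximizers of [k *: a + g] with [k] large are maximizers of [a]. Two of them tie for [a], hence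
    also for [g], which separates points. *)
Lemma sel_cone_generic a g :
  (forall i, {in D i &, injective (fun p => dotp g (v i p))}) ->
  exists2 c, sel_cone c a & forall i, {in maxes c i &, forall p q, p = q}.
Proof.
move=> g_inj; have [k k0 kP] := lexicographic_perturbation a g.
have ka i p : p \in maxes (k *: a + g) i -> p \in maxes a i.
  move=> cp; apply/maxesP; split=> [|q Dq]; first exact: maxes_dom cp.
  by rewrite leNgt; apply/negP => /kP; rewrite ltNge (maxes_le cp Dq).
exists (k *: a + g) => i; first by apply/fintype.subsetP => p /ka.
move=> p q cp cq; apply: (g_inj i); [exact: maxes_dom cp| exact: maxes_dom cq|].
have := maxes_eq cp cq; rewrite !dotpDl !dotpZl.
by rewrite (maxes_eq (ka _ _ cp) (ka _ _ cq)) => /addrI.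
Qed.

Lemma face_sel_cone a c : sel_cone c a -> face (sel_cone c) (sel_cone a).
Proof.
move=> ca; split; first by exists a; exact: sel_cone_refl.
(* On [sel_cone c] each [p] stays maximal, so each difference is nonpositive there. Their sum is 0
   exactly where every [q] is maximal too, that is, on [sel_cone a]. *)
pose b := \sum_i \sum_(p in maxes c i) \sum_(q in maxes a i) (v i q - v i p).
have bE x : dotp b x = \sum_i \sum_(p in maxes c i) \sum_(q in maxes a i)
    (dotp x (v i q) - dotp x (v i p)).
  rewrite dotp_suml; apply: eq_bigr => i _; rewrite dotp_suml.
  apply: eq_bigr => p _; rewrite dotp_suml; apply: eq_bigr => q _.
  by rewrite dotpC dotpBr.
have term_le0 x i p q : sel_cone c x -> p \in maxes c i -> q \in maxes a i ->
    dotp x (v i q) - dotp x (v i p) <= 0.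
  move=> cx cp aq; rewrite subr_le0; apply: maxes_le (maxes_dom aq).
  exact: fintype.subsetP (cx i) p cp.
have b_le0 x : sel_cone c x -> dotp b x <= 0.
  move=> cx; rewrite bE; do 3 (apply: sumr_le0 => ? ?).
  exact: term_le0.
exists b; apply/seteqP; split=> x.
  move=> ax; have cx : sel_cone c x.
    by move=> i; apply: fintype.subset_trans (ca i) (ax i).
  split=> // y cy; apply: le_trans (b_le0 y cy) _; rewrite bE.
  rewrite big1 // => i _; rewrite big1 // => p cp; rewrite big1 // => q aq.
  apply/eqP; rewrite subr_eq0; apply/eqP/(@maxes_eq _ i).
    exact: fintype.subsetP (ax i) q aq.
  exact: fintype.subsetP (cx i) p cp.
move=> [cx x_max] i; apply/fintype.subsetP => q aq.
have [p cp] := maxes_nonempty c (maxes_dom aq).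
apply: (@maxes_trans _ _ p); [exact: fintype.subsetP (cx i) p cp|exact: maxes_dom aq|].
rewrite -subr_ge0 -oppr_le0 opprB.
have : 0 <= dotp b x by rewrite -(dotp0 b); apply: x_max; exact: sel_cone0.
(* Isolate the term of [i], [p], [q]: the three remainders are nonpositive and the total is
   nonnegative, so this term is nonnegative. *)
rewrite bE (bigD1 i) //= (bigD1 p) //= (bigD1 q) //=.
set t1 := \sum_(_ in _ | _) _; set t2 := \sum_(_ in _ | _) _.
set t3 := \sum_(_ | _) _.
have t10 : t1 <= 0 by apply: sumr_le0 => j /andP[aj _]; exact: term_le0.
have t20 : t2 <= 0.
  apply: sumr_le0 => j /andP[cj _]; apply: sumr_le0 => l al; exact: term_le0.
have t30 : t3 <= 0 by do 3 (apply: sumr_le0 => ? ?); exact: term_le0.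
lra.
Qed.

(** A face is generated, as a [sel_cone], by any of its relative interior points; these are found as
    the points of [F] with the fewest maximizers. *)
Lemma face_sel_coneP a F :
  face (sel_cone a) F -> exists c, sel_cone a c /\ F = sel_cone c.
Proof.
move=> [[z Fz] [b FE]].
have FP x : F x <-> sel_cone a x /\ dotp b x = 0.
  (* The maximum of [b] on the cone is attained at [z]; comparing [z] with [z + z] and with 0 shows
     that it is 0. *)
  have bz0 : dotp b z = 0.
    move: Fz; rewrite FE => -[az z_max].
    have := z_max _ (sel_coneD az az); have := z_max _ (sel_cone0 a).
    by rewrite dotpDr dotp0; lra.
  split.
    rewrite FE => -[ax x_max]; split=> //; move: Fz; rewrite FE => -[az z_max].
    by have := x_max _ az; have := z_max _ ax; lra.
  move=> [ax bx0]; rewrite FE; split=> // y ay.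
  by move: Fz; rewrite FE => -[_ /(_ y ay)]; rewrite bz0 bx0.
have b_le0 y : sel_cone a y -> dotp b y <= 0.
  move=> ay; have [_ <-] := (FP z).1 Fz.
  by move: Fz; rewrite {1}FE => -[_ /(_ y ay)].
have size_ex : exists m, `[< exists2 x, F x & \sum_i #|maxes x i| = m :> nat >].
  by exists (\sum_i #|maxes z i|)%N; apply/asboolP; exists z.
have [m /asboolP[x0 Fx0 x0m] m_min] := ex_minnP size_ex.
have [ax0 bx0] := (FP x0).1 Fx0.
(* Minimality makes [x0] relatively interior: no element of [F] shrinks its
   argmaxes. *)
have x0_min y : F y -> sel_cone x0 y.
  move=> Fy; have [ay by0] := (FP y).1 Fy.
  have Fxy : F (x0 + y).
    by apply/FP; split; [exact: sel_coneD | rewrite dotpDr bx0 by0 addr0].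
  have sub i : maxes (x0 + y) i = (maxes x0 i :&: maxes y i)%SET.
    have [D0|[p Dp]] := set_0Vmem (D i).
      by apply/setP => p; rewrite !inE D0 inE.
    have [q aq] := maxes_nonempty a Dp.
    by apply: maxesD (fintype.subsetP (ax0 i) q aq) (fintype.subsetP (ay i) q aq).
  have le_m : (m <= \sum_i #|maxes (x0 + y) i|)%N.
    by apply: m_min; apply/asboolP; exists (x0 + y).
  move=> i; apply/finset.setIidPl/eqP; rewrite -sub eqEcard sub subsetIl /= leqNgt.
  apply/negP => lt_i; move: le_m; rewrite leqNgt => /negP; apply.
  rewrite -x0m (bigD1 i) //= [ltnRHS](bigD1 i) //= -addSn leq_add //.
    by rewrite sub.
  by apply: leq_sum => j _; rewrite sub subset_leq_card ?subsetIl.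
exists x0; split=> //; apply/seteqP; split=> y; first exact: x0_min.
move=> x0y; have ay : sel_cone a y.
  by move=> i; exact: fintype.subset_trans (ax0 i) (x0y i).
apply/FP; split=> //; apply/eqP; rewrite eq_le b_le0 //=.
(* As [y] ties wherever [x0] has tied maximizers, [k *: x0 - y] stays in the cone for large [k].
   There [b] is nonpositive, and it vanishes at [x0], so it is nonnegative at [y]. *)
have [k k0 kP] := lexicographic_perturbation x0 (- y).
have : sel_cone a (k *: x0 - y).
  move=> i; apply/fintype.subsetP => p ap; apply/maxesP; split=> [|q Dq].
    exact: maxes_dom ap.
  have x0p := fintype.subsetP (ax0 i) p ap.
  have [/kP/ltW//|le_pq] := ltP (dotp x0 (v i q)) (dotp x0 (v i p)).
  have x0q := maxes_trans x0p Dq le_pq.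
  rewrite !dotpBl !dotpZl (maxes_eq x0p x0q).
  by rewrite (@maxes_eq y i p q) ?(fintype.subsetP (x0y i)).
by move/b_le0; rewrite dotpBr dotpZr bx0 mulr0 sub0r oppr_le0.
Qed.

Lemma sub_argmax_maxes a c i :
  argmax a [set v i p | p in [set` D i]] `<=`
  argmax c [set v i p | p in [set` D i]] <-> maxes a i \subset maxes c i.
Proof.
split=> [ac|/fintype.subsetP ac].
  apply/fintype.subsetP => p /maxesP[Dp p_max]; apply/maxesP; split=> // q Dq.
  have [|_ cp] := ac (v i p); last by apply: cp; exists q.
  by split; [exists p | move=> _ [r Dr <-]; exact: p_max].
move=> _ [[p Dp <-] p_max]; have /ac/maxesP[_ cp] : p \in maxes a i.
  by apply/maxesP; split=> // q Dq; apply: p_max; exists q.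
by split=> [|_ [q Dq <-]]; [exists p | exact: cp].
Qed.

Lemma argmax_image_nonempty a i : D i != finset.set0 ->
  argmax a [set v i p | p in [set` D i]] !=set0.
Proof.
move=> /set0Pn[p Dp]; have [q /maxesP[Dq q_max]] := maxes_nonempty a Dp.
by exists (v i q); split; [exists q | move=> _ [r Dr <-]; exact: q_max].
Qed.

(** The containment of maximal faces reduces from the sum to its summands, then to their generators.
    Indices with [D i] empty have no summand and impose no condition on [sel_cone]. *)
Lemma outer_normal_fan_minkowski (P : pred I) :
  (forall i, P i = (D i != finset.set0)) ->
  outer_normal_fan (\big[@minkowski_sum R n/[set 0]]_(i | P i)
    convex_hull [set v i p | p in [set` D i]]) = range sel_cone.
Proof.
move=> PD; have A0 a i : P i ->
    argmax a (convex_hull [set v i p | p in [set` D i]]) !=set0.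
  by rewrite PD => Di; apply/argmax_convex_hull_nonempty/argmax_image_nonempty.
rewrite outer_normal_fanE; last by move=> a; exact: argmax_big_nonempty.
congr image; apply/funext => a; apply/seteqP; split=> c.
  move=> /(sub_argmax_big A0) ac i; case: (boolP (P i)) => Pi.
    apply/sub_argmax_maxes/sub_argmax_convex_hull; last first.
      by apply: ac => //; exact: mem_index_enum.
    by apply: argmax_image_nonempty; rewrite -PD.
  apply/fintype.subsetP => p /maxes_dom; move: Pi; rewrite PD negbK => /eqP ->.
  by rewrite inE.
move=> ac; apply/(sub_argmax_big A0) => i _ Pi; apply/sub_argmax_convex_hull.
  by apply: argmax_image_nonempty; rewrite -PD.
exact/sub_argmax_maxes.
Qed.

End SelectionCones.

(** * Binary expansions, and paths as sets of edges *)

Lemma binary_inj n (f g : 'I_n -> bool) :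
  (\sum_k f k * 2 ^ k = \sum_k g k * 2 ^ k)%N -> f =1 g.
Proof.
elim: n f g => [|n IHn] f g; first by move=> _ [].
have split_bit h : (\sum_(k < n.+1) h k * 2 ^ k =
    h ord0 + (\sum_(k < n) h (lift ord0 k) * 2 ^ k).*2)%N.
  rewrite big_ord_recl expn0 muln1 -muln2 big_distrl /=; congr addn.
  by apply: eq_bigr => k _; rewrite /bump /= add1n expnS [(2 * _)%N]mulnC mulnA.
rewrite !split_bit => fg.
have fg0 : f ord0 = g ord0.
  by have := congr1 odd fg; rewrite !oddD !odd_double !addbF !oddb.
have /IHn fgS : (\sum_(k < n) f (lift ord0 k) * 2 ^ k =
    \sum_(k < n) g (lift ord0 k) * 2 ^ k)%N.
  by apply: double_inj; move/eqP: fg; rewrite fg0 eqn_add2l => /eqP.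
by move=> k; case: (unliftP ord0 k) => [j ->|->] //; exact: fgS.
Qed.

Lemma mem_zip1 (S T : eqType) (s : seq S) (t : seq T) (x : S * T) :
  x \in zip s t -> x.1 \in s.
Proof.
elim: s t => [|y s IHs] [|z t] //=; rewrite !inE => /predU1P[->|/IHs ->].
  by rewrite eqxx.
by rewrite orbT.
Qed.

Section Paths.
Variables (V : finType) (E : rel V).
Implicit Types (i j k x : V) (p q : #|V|.-bseq V) (s r : seq V).

(** As nodes do not repeat, [i] is the source of the first pair only. This reads off the first step,
    and deleting that pair leaves the pairs of the tails. *)
Lemma zip_path_inj i s r : uniq (i :: s) -> uniq (i :: r) ->
  zip (i :: s) s =i zip (i :: r) r -> s = r.
Proof.
elim: s i r => [|x s IHs] i [|y r] //; rewrite ![uniq (i :: _)]cons_uniq;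
  move=> /andP[i_s Us] /andP[i_r Ur] eq_zip.
- by have := eq_zip (i, y); rewrite mem_head.
- by have := eq_zip (i, x); rewrite mem_head.
have xy : x = y.
  have := eq_zip (i, x); rewrite mem_head inE => /esym/predU1P[[]//|/mem_zip1 /=].
  by rewrite (negPf i_r).
subst y; congr cons; apply: IHs Us Ur _ => -[u w].
have := eq_zip (u, w); rewrite !inE.
case: eqP => //= -[-> ->] _.
by apply/idP/idP => /mem_zip1 /=; rewrite ?(negPf i_s) ?(negPf i_r).
Qed.

Lemma path_zip i s : path E i s ->
  forall uv, uv \in zip (i :: s) s -> E uv.1 uv.2.
Proof.
elim: s i => [|x s IHs] i //= /andP[Eix Es] uv.
by rewrite inE => /predU1P[->//|]; exact: IHs.
Qed.

Lemma path_edges_inj i j : {in paths E i j &, injective (fun p => path_edges E i p)}.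
Proof.
move=> p q; rewrite !inE => /and3P[Ep _ Up] /and3P[Eq _ Uq] /setP eq_e.
apply/val_inj/(zip_path_inj Up Uq) => uv.
apply/idP/idP => uv_in.
  have Euv := path_zip Ep uv_in.
  by have := eq_e (exist _ uv Euv); rewrite !inE /= uv_in => /esym.
have Euv := path_zip Eq uv_in.
by have := eq_e (exist _ uv Euv); rewrite !inE /= uv_in.
Qed.

Lemma path_edges_cons i x s (Eix : E i x) :
  path_edges E i (x :: s) = (exist _ (i, x) Eix |: path_edges E x s)%SET.
Proof. by apply/setP => e; rewrite !inE. Qed.

Lemma notin_path_edges i x s (e : edge E) :
  i \notin x :: s -> (val e).1 = i -> e \notin path_edges E x s.
Proof.
by move=> i_s e1; rewrite inE; apply: contra i_s => /mem_zip1; rewrite e1.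
Qed.

End Paths.

(** * Path vectors, path polynomials and separating weights *)

Section PathVectors.
Variables (R : realType) (V : finType) (E : rel V).
Implicit Types (C : weights R E) (ij : V * V) (p q : #|V|.-bseq V).

Definition pair_paths ij : {set #|V|.-bseq V} := paths E ij.1 ij.2.

(** The exponent vector of the monomial of [p] in [path_poly]. *)
Definition path_vector ij p : weights R E :=
  \row_k (enum_val k \in path_edges E ij.1 p)%:R.

Lemma dotp_path_vector C ij p : dotp C (path_vector ij p) = path_weight C ij.1 p.
Proof.
rewrite /path_weight big_mkcond /= /dotp (reindex enum_rank) /=; last first.
  by apply: onW_bij; exact: enum_rank_bij.
apply: eq_bigr => e _; rewrite mxE enum_rankK.
by case: ifP; rewrite ?mulr1 ?mulr0.
Qed.

Lemma mem_maxes C i j p :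
  (p \in maxes pair_paths path_vector C (i, j)) = critical C i j p.
Proof.
apply/maxesP/andP => -[ijp p_max]; split=> //.
  apply/forall_inP => q /p_max; by rewrite !dotp_path_vector.
by move=> q ijq; rewrite !dotp_path_vector; apply: (forall_inP p_max).
Qed.

Lemma path_poly_sumX ij : path_poly R E ij =
  \sum_(p in pair_paths ij)
    mpolyX R (\big[mnm_add/mnm0]_(e in path_edges E ij.1 p) mnm1 (enum_rank e)).
Proof. by apply: eq_bigr => p _; rewrite mprodXE. Qed.

Lemma nonneg_coef_path_poly ij : nonneg_coef (path_poly R E ij).
Proof.
rewrite path_poly_sumX; apply: nonneg_coef_sum => p _; exact: nonneg_coefX.
Qed.

(** Path monomials have coefficient 1 and cannot cancel, so the support consists of exactly their
    exponents. *)
Lemma newton_path_poly ij : newton (path_poly R E ij) =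
  convex_hull [set path_vector ij p | p in [set` pair_paths ij]].
Proof.
pose m p : multinom #|edge E| :=
  (\big[mnm_add/mnm0]_(e in path_edges E ij.1 p) mnm1 (enum_rank e)).
have mE p : \row_k (m p k)%:R = path_vector ij p.
  apply/rowP => k; rewrite !mxE mnm_sumE.
  rewrite (eq_bigr (fun e => (e == enum_val k) : nat)) => [|e _]; last first.
    by rewrite mnm1E -(inj_eq enum_rank_inj) enum_valK.
  rewrite big_mkcond (bigD1 (enum_val k)) //= eqxx big1 => [|e /negPf->].
    by rewrite addn0; case: ifP.
  by rewrite if_same.
congr convex_hull; apply/seteqP; split=> x /=.
  move=> [k]; rewrite mcoeff_msupp path_poly_sumX raddf_sum psumr_neq0; last first.
    by move=> p _; rewrite nonneg_coefX.
  move=> /hasP[p _ /andP[ijp]]; rewrite /= mcoeffX -/(m p).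
  case: eqP => [<- _ <-|_]; last by rewrite ltxx.
  by exists p => //; rewrite mE.
move=> [p ijp <-]; exists (m p); last exact: mE.
rewrite /= mcoeff_msupp path_poly_sumX raddf_sum psumr_neq0; last first.
  by move=> q _; rewrite nonneg_coefX.
apply/hasP; exists p; first exact: mem_index_enum.
by rewrite ijp /= mcoeffX eqxx ltr01.
Qed.

Lemma path_weight_separating : exists g : weights R E, forall ij,
  {in pair_paths ij &, injective (fun p => dotp g (path_vector ij p))}.
Proof.
(* With these weights a path weighs the number whose binary digits indicate its edges, and the edges
   determine the path. *)
exists (\row_k (2 ^ k)%:R) => ij p q ijp ijq.
have gE r : dotp (\row_k (2 ^ k)%:R) (path_vector ij r) =
    (\sum_(k < #|edge E|) (enum_val k \in path_edges E ij.1 r) * 2 ^ k)%:R.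
  by rewrite natr_sum; apply: eq_bigr => k _; rewrite !mxE natrM mulrC.
rewrite !gE => /eqP; rewrite eqr_nat => /eqP/binary_inj pq.
apply: (path_edges_inj ijp ijq); apply/setP => e.
by have := pq (enum_rank e); rewrite enum_rankK.
Qed.

End PathVectors.

(** * Paths in a DAG, and recovering critical paths from the maxoid *)

Section AcyclicPaths.
Variables (V : finType) (E : rel V).
Hypothesis acyclicE : acyclic E.
Implicit Types (i j k x : V) (p q : #|V|.-bseq V) (s r : seq V).

Lemma acyclic_path_closed i s : path E i s -> last i s = i -> s = [::].
Proof.
case/lastP: s => // s x; rewrite last_rcons => Es xi; subst x.
by have /= := @acyclicE (i :: s) Es.
Qed.

Lemma connect_anti x y : connect E x y -> connect E y x -> x = y.
Proof.
move=> /connectP[s Es ->] /connectP[r Er rx].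
have := @acyclic_path_closed x (s ++ r).
rewrite cat_path Es Er last_cat -rx => /(_ isT erefl).
by case: s {Es Er rx}.
Qed.

Lemma acyclic_path_uniq i s : path E i s -> uniq (i :: s).
Proof.
elim: s i => [|x s IHs] i // Exs; have /andP[_ /IHs Us] := Exs.
rewrite cons_uniq Us andbT; apply/negP => /splitPr ixs.
case: _ / ixs Exs => s1 s2; rewrite cat_path => /and3P[E1 E2 _].
have := @acyclic_path_closed i (rcons s1 i).
rewrite rcons_path E1 E2 last_rcons => /(_ isT erefl).
by case: s1 {E1 E2}.
Qed.

Lemma mem_paths i j p : (p \in paths E i j) = path E i p && (last i p == j).
Proof.
rewrite inE andbA; case: (path E i p) / idP => //= Ep.
by rewrite -cons_uniq acyclic_path_uniq ?andbT.
Qed.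

(** In a DAG no path repeats a node, so its length obeys the bound of the encoding. *)
Lemma path_bseq i s : path E i s -> exists p, p = s :> seq V.
Proof.
move=> /acyclic_path_uniq /= /andP[_ Us].
have size_s : (size s <= #|V|)%N by rewrite -(card_uniqP Us) max_card.
by exists (Bseq size_s).
Qed.

Lemma paths_connect i j p : p \in paths E i j -> connect E i j.
Proof. by rewrite mem_paths => /andP[Ep /eqP<-]; apply/connectP; exists p. Qed.

Lemma paths_self i p : p \in paths E i i -> p = [::] :> seq V.
Proof. by rewrite mem_paths => /andP[Ep /eqP]; exact: acyclic_path_closed. Qed.

Section Weights.
Variable R : realType.
Implicit Types C : weights R E.

Lemma path_weight_cons C i x s (Eix : E i x) : path E x s ->
  path_weight C i (x :: s) =
  C 0 (enum_rank (exist _ (i, x) Eix : edge E)) + path_weight C x s.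
Proof.
move=> Es; rewrite /path_weight path_edges_cons big_setU1 //=.
apply: notin_path_edges => //.
have := @acyclic_path_uniq i (x :: s).
by rewrite [path _ _ _]/= Eix Es cons_uniq => /(_ isT)/andP[].
Qed.

(** Optimal substructure: prepending the edge from [i] to [x] to a competing tail adds the same
    weight to both. *)
Lemma critical_tail C i j p x s : critical C i j p -> p = x :: s :> seq V ->
  exists2 q, critical C x j q & q = s :> seq V.
Proof.
move=> /andP[+ /forall_inP p_max] ps; rewrite mem_paths ps /= => /andP[/andP[Eix Es] sj].
have [q qs] := path_bseq Es.
exists q => //; apply/andP; split; first by rewrite mem_paths qs Es.
apply/forall_inP => r; rewrite mem_paths => /andP[Er rj].
have [|p' p'E] := @path_bseq i (x :: r); first by rewrite /= Eix.
have := p_max p'; rewrite mem_paths p'E /= Eix Er rj => /(_ isT).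
by rewrite ps !(path_weight_cons _ Eix) // lerD2l qs.
Qed.

Lemma crit_dag_connect C (L : {set V}) i j :
  crit_dag C L i j -> i != j /\ connect E i j.
Proof.
move=> /and3P[ij /card_gt0P[p /paths_connect Eij] _]; by split.
Qed.

(* Conditioning on [L = {v != i : v ~> x}] blocks the critical path of [C],
   while no node of [L] lies on the path through [x']. *)
Lemma maxoid_first_step C C' i j p p' x x' s s' :
  generic E C' -> maxoid E C = maxoid E C' ->
  critical C i j p -> p = x :: s :> seq V ->
  critical C' i j p' -> p' = x' :: s' :> seq V ->
  ~~ connect E x' x -> False.
Proof.
move=> genC' eqM crit_p ps crit_p' ps' x'x.
have [] := andP crit_p; rewrite mem_paths ps => /andP[/andP[Eix Es] /eqP/= sj] _.
have [] := andP crit_p'; rewrite mem_paths ps' => /andP[/andP[Eix' Es'] /eqP/= sj'] _.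
have x'j : connect E x' j by apply/connectP; exists s'.
have xj : connect E x j by apply/connectP; exists s.
have ix := connect1 Eix; have ix' := connect1 Eix'.
have neq_ij : i != j.
  apply/eqP => ij; have [] := andP crit_p; rewrite -ij => /paths_self.
  by rewrite ps.
have neq_xj : x != j by apply: contraNneq x'x => ->.
have neq_ix : i != x.
  apply/eqP => ix0; have := @acyclicE [:: i].
  by rewrite /= {2}ix0 Eix => /(_ isT).
pose L := [set k | (k != i) && connect E k x]%SET.
have LP k : k \notin L -> connect E k x -> k = i.
  by rewrite inE => + kx; rewrite kx andbT negbK => /eqP.
have iL : i \notin L by rewrite inE eqxx.
have jL : j \notin L.
  rewrite inE negb_and; apply/orP; right; apply: contra neq_xj => jx.
  by rewrite (connect_anti xj jx).
have into_i k : k \notin L -> crit_dag C L k i -> False.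
  move=> kL /crit_dag_connect[/eqP ki k_i].
  by case: ki; apply: LP kL _; exact: (connect_trans k_i ix).
have into_L k l : k \notin L -> l \in L -> k != i -> crit_dag C L k l -> False.
  rewrite [in l \in L]inE => kL /andP[_ lx] /eqP ki /crit_dag_connect[_ kl].
  by case: ki; apply: LP kL _; exact: (connect_trans kl lx).
have not_ij : ~~ crit_dag C L i j.
  rewrite /crit_dag neq_ij; apply/negP => /and3P[_ _ /forallP/(_ p)].
  rewrite crit_p /= => /pred0P/(_ x) /=.
  by rewrite !inE ps mem_head /= sj neq_xj eq_sym neq_ix connect0.
have neq_ji : j != i by rewrite eq_sym.
(* Each connecting form, in either direction, is the edge from [i] to [j] or contains an edge into
   [i] from outside [L], or an edge into [L] from a node outside [L] other than [i]. *)
have sepC : ~~ cstar_connected C L i j.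
  rewrite /cstar_connected negb_or; apply/andP; split; apply/negP => /or4P.
    case=> [|/existsP[k /and4P[kL _ ki _]]|/existsP[l /and4P[lL _ _ jl]]|].
    - exact/negP.
    - exact: into_i ki.
    - exact: into_L jl.
    case/orP=> /existsP[k /existsP[l /andP[lL]]].
      by move=> /and5P[kL _ ki _ _]; exact: into_i ki.
    move=> /existsP[q /and5P[kL _ _ ki _]]; exact: into_i ki.
  case=> [|/existsP[k /and4P[kL _ _ ki]]|/existsP[l /and4P[lL _ jl _]]|].
  - exact: into_i.
  - exact: into_i ki.
  - exact: into_L jl.
  case/orP=> /existsP[k /existsP[l /andP[lL]]].
    move=> /and5P[kL Uk _ kl _].
    have ki : k != i.
      by move: Uk; rewrite /= !inE !negb_or -!andbA => /and5P[_ _ _ _ /andP[]].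
    exact: into_L kL lL ki kl.
  move=> /existsP[q /and5P[_ qL _ _ /and3P[_ _ qi]]]; exact: into_i qi.
have : (finset.set1 i, finset.set1 j, L) \in maxoid E C.
  rewrite inE !disjoints1 finset.in_set1 neq_ij iL jL /=.
  apply/forall_inP => _ /finset.set1P->; apply/forall_inP => _ /finset.set1P->.
  exact: sepC.
rewrite eqM inE => /and4P[_ _ _ /forall_inP/(_ i)].
rewrite finset.in_set1 eqxx => /(_ isT)/forall_inP/(_ j).
rewrite finset.in_set1 eqxx => /(_ isT)/negP; apply.
(* For [C'] the edge from [i] to [j] is present: its only critical path is [p'], whose nodes after
   [i] are reachable from [x'] and so cannot reach [x]. *)
have p'ij : p' \in paths E i j by case/andP: crit_p'.
rewrite /cstar_connected /cstar_path; apply/orP; left; apply/orP; left.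
apply/and3P; split; [exact: neq_ij | by apply/card_gt0P; exists p' |].
apply/forallP => q; apply/implyP => crit_q.
have -> : q = p'.
  move: genC' => /forallP/(_ i)/forallP/(_ j)/implyP.
  rewrite neq_ij => /(_ _)/cards1P[|p0 p0E]; first by apply/card_gt0P; exists p'.
  move: crit_q crit_p'.
  rewrite -!(finset.in_set (critical C' i j)) p0E !finset.in_set1.
  by move=> /eqP-> /eqP.
apply/pred0P => k /=; apply/negP => /andP[]; rewrite !inE ps' => /andP[kp' _].
move=> /andP[_ kx]; case/negP: x'x; apply: (connect_trans _ kx).
exact: (path_connect Es').
Qed.

(** Common first steps are stripped off. Where the paths diverge, antisymmetry of reachability
    leaves one of [x], [x'] not reaching the other, and [maxoid_first_step] applies with [C] and
    [C'] in the suitable order. *)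
Lemma maxoid_critical_uniq C C' i j p p' : generic E C -> generic E C' ->
  maxoid E C = maxoid E C' -> critical C i j p -> critical C' i j p' -> p = p'.
Proof.
move=> gC gC' eqM crit_p crit_p'; apply: val_inj => /=.
move ps: (val p) => s; elim: s i p p' ps crit_p crit_p' => [|x s IHs] i p p' ps.
  move=> /andP[+ _] /andP[+ _]; rewrite [p \in _]mem_paths ps /= => /eqP<-.
  by move=> /paths_self ->.
move=> crit_p crit_p'; case ps': (val p') => [|x' s'].
  have [+ _] := andP crit_p'; rewrite mem_paths ps' /= => /eqP ij.
  by have [+ _] := andP crit_p; rewrite -ij => /paths_self; rewrite ps.
have [xx'|xx'] := eqVneq x x'.
  subst x'; have [q crit_q qs] := critical_tail crit_p ps.
  have [q' crit_q' qs'] := critical_tail crit_p' ps'.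
  by congr cons; rewrite (IHs x q q' qs crit_q crit_q') qs'.
case: (boolP (connect E x' x)) => [x'x|]; last first.
  by case/(maxoid_first_step gC' eqM crit_p ps crit_p' ps').
case: (boolP (connect E x x')) => [x_x'|].
  by rewrite (connect_anti x_x' x'x) eqxx in xx'.
by case/(maxoid_first_step gC (esym eqM) crit_p' ps' crit_p ps).
Qed.

End Weights.
End AcyclicPaths.

(** * Both fans as the family of selection cones *)

Section MaxoidFanTheory.
Variables (R : realType) (V : finType) (E : rel V).
Hypothesis acyclicE : acyclic E.
Implicit Types C : weights R E.

Local Notation path_maxes := (maxes (@pair_paths V E) (@path_vector R V E)).
Local Notation path_sel_cone := (sel_cone (@pair_paths V E) (@path_vector R V E)).

(** Diagonal pairs cause no discrepancy: by acyclicity their only path is the empty one. *)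
Lemma genericP C :
  generic E C <-> forall ij, {in path_maxes C ij &, forall p q, p = q}.
Proof.
split=> [genC [i j] p q | uniqC].
  rewrite !mem_maxes; have [<-|ij] := eqVneq i j.
    by move=> /andP[/(paths_self acyclicE) p0 _] /andP[/(paths_self acyclicE) q0 _];
      apply: val_inj; rewrite /= p0 q0.
  move=> crit_p; move: genC => /forallP/(_ i)/forallP/(_ j)/implyP.
  rewrite ij => /(_ _)/cards1P[|r rE].
    by apply/card_gt0P; exists p; case/andP: crit_p.
  move: crit_p; rewrite -!(finset.in_set (critical C i j)) rE !finset.in_set1.
  by move=> /eqP-> /eqP->.
apply/forallP => i; apply/forallP => j; apply/implyP => /andP[_ /card_gt0P[p ijp]].
have [q Cq] := @maxes_nonempty R _ _ _ (@pair_paths V E) (@path_vector R V E) C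
  (i, j) p ijp.
apply/cards1P; exists q; apply/setP => r; rewrite !inE.
apply/idP/eqP => [|->]; last by rewrite -mem_maxes.
by rewrite -mem_maxes => Cr; apply: uniqC Cr Cq.
Qed.

(** Weights enter [crit_dag], and through it the maxoid, only by way of [critical]. *)
Lemma maxoid_congr C C' :
  (forall ij, path_maxes C ij = path_maxes C' ij) -> maxoid E C = maxoid E C'.
Proof.
move=> eqCC'; have eq_crit i j p : critical C i j p = critical C' i j p.
  by rewrite -!mem_maxes eqCC'.
have eq_dag L : crit_dag C L = crit_dag C' L.
  apply/funext => i; apply/funext => j; congr [&& _, _ & _].
  by apply: eq_forallb => p; rewrite eq_crit.
have eq_sep A B L : cstar_separated C A B L = cstar_separated C' A B L.
  apply: eq_forallb_in => i _; apply: eq_forallb_in => j _.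
  by rewrite /cstar_connected /cstar_path eq_dag.
by apply/setP => -[[A B] L]; rewrite [LHS]inE [RHS]inE eq_sep.
Qed.

(** Puts the cone in the form required by [closure_maxes]: for generic weights, maxoid and critical
    paths determine each other. *)
Lemma maxoid_coneE C : generic E C ->
  maxoid_cone C = [set c | forall ij, path_maxes c ij = path_maxes C ij].
Proof.
move=> genC; apply/seteqP; split=> c /=.
  move=> [genc eqM] [i j].
  have sub (C1 C2 : weights R E) : generic E C1 -> generic E C2 ->
      maxoid E C1 = maxoid E C2 -> path_maxes C1 (i, j) \subset path_maxes C2 (i, j).
    move=> gen1 gen2 eq12; apply/fintype.subsetP => p C1p.
    have [q C2q] := @maxes_nonempty R _ _ _ (@pair_paths V E) (@path_vector R V E)
      C2 _ _ (maxes_dom C1p).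
    have crit1 : critical C1 i j p by rewrite -mem_maxes; exact: C1p.
    have crit2 : critical C2 i j q by rewrite -mem_maxes; exact: C2q.
    have -> := maxoid_critical_uniq acyclicE gen1 gen2 eq12 crit1 crit2.
    exact: C2q.
  apply/eqP; rewrite finset.eqEsubset; apply/andP; split.
    exact: sub genc genC eqM.
  exact: sub genC genc (esym eqM).
move=> eqm; split; last exact: maxoid_congr.
by apply/genericP => ij p q; rewrite eqm; apply: (genericP C).1.
Qed.

Lemma maxoid_fanE : maxoid_fan R E = range path_sel_cone.
Proof.
apply/seteqP; split=> N.
  move=> [C genC]; rewrite maxoid_coneE // closure_maxes.
  by move=> /face_sel_coneP[c [_ ->]]; exists c.
move=> [a _ <-]; have [g g_inj] := path_weight_separating R E.
have [C Ca C_uniq] := sel_cone_generic a g_inj.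
have genC : generic E C by apply/genericP.
exists C => //; rewrite maxoid_coneE // closure_maxes; exact: face_sel_cone.
Qed.

Lemma path_polytope_fan : outer_normal_fan (path_polytope R E) = range path_sel_cone.
Proof.
rewrite /path_polytope; under eq_bigr => ij _ do rewrite newton_path_poly.
(* [path_pair] omits the diagonal, where [pair_paths] still contains the empty path. Emptying these
   sets leaves the cones unchanged, since a single path is always maximal. *)
pose D ij := if ij.1 == ij.2 then finset.set0 else @pair_paths V E ij.
have selE : sel_cone D (@path_vector R V E) = path_sel_cone.
  apply/funext => a; apply/seteqP; split=> c ac ij.
    have := ac ij; rewrite /maxes /D; case: eqP => // ij0 _.
    apply/fintype.subsetP => p /maxes_dom ijp; apply/maxesP; split=> // q ijq.
    rewrite /pair_paths -ij0 in ijp ijq.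
    by rewrite (val_inj (etrans (paths_self acyclicE ijp)
      (esym (paths_self acyclicE ijq)))).
  have := ac ij; rewrite /maxes /D; case: eqP => // ij0 _.
  by apply/fintype.subsetP => p; rewrite inE finset.in_set0.
rewrite -selE -(@outer_normal_fan_minkowski _ _ _ _ _ _ (path_pair E)).
  congr outer_normal_fan; apply: eq_bigr => ij /andP[ij0 _].
  by rewrite /D (negPf ij0).
move=> ij; rewrite /path_pair /D card_gt0; case: eqP => //=.
by rewrite eqxx.
Qed.

End MaxoidFanTheory.

Theorem theorem3p1 (R : realType) (V : finType) (E : rel V)
    (acyclicE : acyclic E) :
  maxoid_fan R E = outer_normal_fan (path_polytope R E) /\
  maxoid_fan R E =
    outer_normal_fan (newton (\prod_(ij | path_pair E ij) path_poly R E ij)).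
Proof.
have fanE := maxoid_fanE R acyclicE.
rewrite newton_prod => [|ij _]; last exact: nonneg_coef_path_poly.
by split; rewrite fanE -path_polytope_fan.
Qed.
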